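(* Define, for positive integers $s,\ell$, $$f(s,\ell)=\begin{cases}1+\dfrac{1}{2+s/\ell} & \text{if } \ell\le s/2,\\[2mm] \dfrac54 & \text{if } s/2<\ell\le 5s/6,\\[2mm] 1+\dfrac{2}{3+6\ell/s} & \text{if } 5s/6<\ell.\end{cases}$$ There exist a deterministic online algorithm $A$ for the Restricted Grid Scheduling problem and an absolute constant $C>0$ such that for every integer $S\ge 2$, all positive integers $s,\ell$, and every admissible sequence of bins $\sigma$, letting $I$ consist of $s$ items of size $S$ and $\ell$ items of size $L=2S-1$, $$A(I,\sigma)\le f(s,\ell)\cdot \mathrm{OPT}(I,\sigma)+C\cdot S .$$
   Context: Restricted Grid Scheduling: fix an integer $S>1$, put $L=2S-1$ and $M=4S-3=2L-1$. A set (multiset) $I$ of items is given in advance, every item having size $S$ or $L$. Bins with integer sizes in $[S,M]$ arrive one at a time in a sequence $\sigma$; the sequence is admissible if it ends with at least as many bins of size $M$ as there are items (so all items can always be packed). A partial packing assigns some items to bins so that the total size of items in each bin is at most the bin size; a packing assigns all items. A (partial) packing is valid if every bin that receives no item is smaller than every unpacked item and smaller than every item packed in a later bin. The cost of a packing is the sum of the sizes of the bins that receive at least one item. $\mathrm{OPT}(I,\sigma)$ is the minimum cost of a valid packing of $I$ into $\sigma$. A deterministic online algorithm knows $I$ (hence $S$, $s$, $\ell$) in advance, sees the bins one at a time, must irrevocably decide which items go into the current bin before seeing the next one, and must produce a valid packing; $A(I,\sigma)$ denotes the cost of its packing. *)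

(* Defs.v *)
From HB Require Import structures.
From mathcomp Require Import all_boot all_order all_algebra.
Set Implicit Arguments. Unset Strict Implicit. Unset Printing Implicit Defensive.
Import Order.TTheory GRing.Theory Num.Theory.

(* Restricted Grid Scheduling with parameter S:  L = 2S-1, M = 4S-3.
   The item multiset I consists of [s] items of size S and [l] items of size L.
   Items of equal size are interchangeable, so a (partial) packing of I into a
   bin sequence [sigma : seq nat] is described by a function
   [p : nat -> nat * nat] : bin number i (0-based, i < size sigma) receives
   (p i).1 items of size S and (p i).2 items of size L. *)

Definition gsL (S : nat) : nat := S.*2 - 1.
Definition gsM (S : nat) : nat := 4 * S - 3.

Definition bin (sigma : seq nat) (i : nat) : nat := nth 0 sigma i.

Definition packedS (sigma : seq nat) (p : nat -> nat * nat) : nat :=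
  \sum_(i < size sigma) (p i).1.
Definition packedL (sigma : seq nat) (p : nat -> nat * nat) : nat :=
  \sum_(i < size sigma) (p i).2.

Definition fits (S : nat) (sigma : seq nat) (p : nat -> nat * nat) : bool :=
  all (fun i => (p i).1 * S + (p i).2 * gsL S <= bin sigma i)
      (iota 0 (size sigma)).

Definition emptyb (p : nat -> nat * nat) (i : nat) : bool := p i == (0, 0).

Definition partial_packing (S s l : nat) (sigma : seq nat)
    (p : nat -> nat * nat) : bool :=
  [&& fits S sigma p, packedS sigma p <= s & packedL sigma p <= l].

Definition valid (S s l : nat) (sigma : seq nat) (p : nat -> nat * nat) : bool :=
  partial_packing S s l sigma p &&
  all (fun i => emptyb p i ==>
     [&& ((packedS sigma p < s) ||
          has (fun j => 0 < (p j).1) (iota i.+1 (size sigma - i.+1)))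
            ==> (bin sigma i < S)
       & ((packedL sigma p < l) ||
          has (fun j => 0 < (p j).2) (iota i.+1 (size sigma - i.+1)))
            ==> (bin sigma i < gsL S)])
    (iota 0 (size sigma)).

Definition valid_packing (S s l : nat) (sigma : seq nat)
    (p : nat -> nat * nat) : bool :=
  [&& valid S s l sigma p, packedS sigma p == s & packedL sigma p == l].

Definition cost (sigma : seq nat) (p : nat -> nat * nat) : nat :=
  \sum_(i < size sigma | ~~ emptyb p i) bin sigma i.

Definition admissible (S s l : nat) (sigma : seq nat) : bool :=
  [&& all (fun b => S <= b <= gsM S) sigma,
      s + l <= size sigma
    & all (fun b => b == gsM S) (drop (size sigma - (s + l)) sigma)].

(* Finite encoding of packings, used to define OPT as a minimum.  Any valid
   packing puts at most s S-items and at most l L-items in a bin. *)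
Definition fpack (n s l : nat) := {ffun 'I_n -> 'I_s.+1 * 'I_l.+1}.

Definition fpack_fun (n s l : nat) (P : fpack n s l) : nat -> nat * nat :=
  fun i => match insub i with
           | Some k => (nat_of_ord (P k).1, nat_of_ord (P k).2)
           | None => (0, 0)
           end.

(* OPT(I, sigma): minimum cost of a valid packing (the default value
   \sum sigma is an upper bound on every cost, so it is never smaller than
   the true minimum when a valid packing exists, which is the case for
   admissible sigma). *)
Definition OPT (S s l : nat) (sigma : seq nat) : nat :=
  \big[minn/(\sum_(b <- sigma) b)]_(P in [pred Q : fpack (size sigma) s l |
        valid_packing S s l sigma (fpack_fun Q)])
     cost sigma (fpack_fun P).

(* Deterministic online algorithm: knows S, s, l in advance; on the arrival
   of bin i it sees the sizes of bins 0..i (its own earlier decisions are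
   determined by these, being deterministic) and decides how many S-items and
   L-items go into bin i. *)
Definition online_alg := nat -> nat -> nat -> seq nat -> nat * nat.

Definition run (A : online_alg) (S s l : nat) (sigma : seq nat) : nat -> nat * nat :=
  fun i => A S s l (take i.+1 sigma).

Definition correct_alg (A : online_alg) : Prop :=
  forall S s l sigma, 1 < S -> admissible S s l sigma ->
    valid_packing S s l sigma (run A S s l sigma).

Definition Acost (A : online_alg) (S s l : nat) (sigma : seq nat) : nat :=
  cost sigma (run A S s l sigma).

Local Open Scope ring_scope.

Definition fratio (s l : nat) : rat :=
  if l%:R <= s%:R / 2 :> rat then 1 + 1 / (2 + s%:R / l%:R)
  else if l%:R <= 5 * s%:R / 6 :> rat then 5 / 4
  else 1 + 2 / (3 + 6 * l%:R / s%:R).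

(* Main.v *)
Require Import Defs.
From HB Require Import structures.
From mathcomp Require Import all_boot all_order all_algebra.
From mathcomp Require Import zify ring lra.
Import Order.TTheory GRing.Theory Num.Theory.

(** Write H = L = 2S - 1, give an S-item weight 1 and an L-item weight 2, and put
    tau = (f - 1)(s + 2l); since OPT >= (H/2)(s + 2l), it suffices to lose at
    most (H/2) tau + O(S) against an arbitrary valid packing.  The only real
    choice is in the flexible bins (size >= 2S, size <> 3S - 1): pack an L, or
    as many S-items as possible.  The algorithm packs an L in the first tau/2
    flexible bins, then S-items in the next_state s/2 - tau/2 ones, then L again.  Let
    q and g count the flexible bins of either kind.  If the S-items last longer,
    the loss is at most H times the surplus of items the other packing has
    placed, which is at most min(q, s/2 - g).  If the L-items last longer, let u
    be the surplus of L-items placed by the other packing and m the number of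
    L-items left; then the other packing still has 2u S-items to place, and the
    loss is at most (H/2) min(4u, m + u), where u <= g and m + q <= l.  The
    three regimes of f are those where different terms of these minima decide
    that everything is at most (H/2) tau. *)

(** * Packing rule and loss invariant *)

(** At size [3 * S - 1] an S-item and an L-item together weigh 3 and two S-items only 2, so there is
    no choice; in any other bin of size at least [2 * S] both fillings weigh the same. *)
Definition flex (S b : nat) : bool := (2 * S <= b) && (b != 3 * S - 1).

Definition capS (S b : nat) : nat := 1 + (2 * S <= b) + (3 * S <= b).

Definition pack_bin (S Q G sr lr q g b : nat) : nat * nat :=
  if lr == 0 then (minn (capS S b) sr, 0)
  else if sr == 0 then (0, (gsL S <= b) : nat)
  else if b < gsL S then (1, 0)
  else if [&& flex S b, Q <= q & g < G] then (minn (capS S b) sr, 0)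
  else ((3 * S - 1 <= b) : nat, 1).

(* [sr], [lr], [cA] are the items left to the algorithm and its cost so far,
   [so], [lo], [cO] those of the packing it is compared with; [q] and [g] count
   the flexible bins in which the algorithm packed an L-item, resp. no L-item.
   In [InvLargeAhead], [m] and [u] are the values of [lr] and [lr - lo] at the
   time the algorithm ran out of S-items. *)
Inductive invariant (S s l Q G Y sr lr q g cA so lo cO : nat) : Prop :=
| InvBoth of 0 < sr & 0 < lr & g <= G & (g = 0 \/ Q <= q)
    & (q <= Q \/ G <= g)
    & sr + 2 * lr <= so + 2 * lo & lr <= lo + g & lr + q <= l & so <= s
    & (0 < so -> cA = cO)
    & cA + gsL S * (sr + lr) <= cO + gsL S * (so + lo + q)
    & 2 * cA + gsL S * (2 * (sr + lr + g)) <= 2 * cO + gsL S * (so + 2 * lo + s)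
| InvSmall of lr = 0 & 0 < sr & (0 < so -> cA = cO)
    & cA + gsL S * sr <= cO + gsL S * (so + lo + Q)
| InvLargeBehind of sr = 0 & 0 < lr & so = 0 & lr <= lo + 1
    & cA + gsL S * lr <= cO + gsL S * (lo + Q + 2)
| InvLargeAhead u m of sr = 0 & 0 < lr & minn (4 * u) (m + u + 2) <= Y
    & cA <= cO & lr <= lo + u
    & 2 * cA + gsL S * (3 * lr) <= 2 * cO + gsL S * (so + 2 * lo + m + 2)
| InvLargeOnly of sr = 0 & 0 < lr & so = 0 & lo = 0
    & 2 * cA + gsL S * (4 * lr) <= 2 * cO + gsL S * Y
| InvDone of sr = 0 & lr = 0 &
    (cA <= cO \/ so = 0 /\ 2 * cA <= 2 * cO + gsL S * (2 * lo + Y)).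

Definition paid (b : nat) (d : nat * nat) : nat := if d == (0, 0) then 0 else b.

(** * Preservation of the invariant by one bin *)

Section Step.
Variables S s l Q G Y : nat.
Hypothesis S2 : 2 <= S.
Hypothesis sGQ : s <= 2 * (G + Q).
Hypothesis QY : 2 * Q + 6 <= Y.
Hypothesis uY : forall u m, u <= G -> u <= m -> m + Q <= l ->
  minn (4 * u) (m + u + 2) <= Y.

(** The five size ranges [S, 2S-2], {2S-1}, [2S, 3S-2], {3S-1}, [3S, 4S-3], keeping only the bounds
    that the cost estimates use. *)
Inductive bin_spec (b : nat) : bool -> bool -> nat -> bool -> Prop :=
| BinA of b < gsL S : bin_spec b true false 1 false
| BinB of b = gsL S : bin_spec b false false 1 false
| BinC of gsL S <= b & b <= 2 * gsL S : bin_spec b false true 2 false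
| BinD of gsL S <= b & b <= 2 * gsL S : bin_spec b false false 2 true
| BinE of gsL S <= b & b <= 2 * gsL S : bin_spec b false true 3 true.

Lemma binP b : S <= b -> b <= gsM S ->
  bin_spec b (b < gsL S) (flex S b) (capS S b) (3 * S - 1 <= b).
Proof.
rewrite /flex /capS /gsM => h1 h2.
case: (ltnP b (gsL S)) => h3.
  have -> : 2 * S <= b = false by rewrite /gsL in h3; lia.
  have -> : 3 * S <= b = false by rewrite /gsL in h3; lia.
  have -> : 3 * S - 1 <= b = false by rewrite /gsL in h3; lia.
  by constructor.
case: (leqP (2 * S) b) => h4; last first.
  have -> : 3 * S <= b = false by lia.
  have -> : 3 * S - 1 <= b = false by lia.
  by constructor; rewrite /gsL in h3 *; lia.
have h5 : b <= 2 * gsL S by rewrite /gsL; lia.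
case: (leqP (3 * S) b) => h6.
  have -> : b != 3 * S - 1 by lia.
  have -> : 3 * S - 1 <= b by lia.
  by constructor.
case: (eqVneq b (3 * S - 1)) => h7 /=.
  rewrite h7 leqnn -h7; by constructor.
have -> : 3 * S - 1 <= b = false by lia.
by constructor.
Qed.

Inductive move_spec b so lo (cap : nat) (sl : bool) : nat -> nat -> Prop :=
| MoveSkip of so = 0 & (gsL S <= b -> lo = 0) : move_spec b so lo cap sl 0 0
| Move1S : move_spec b so lo cap sl 1 0
| Move2S of gsL S < b & 2 <= cap : move_spec b so lo cap sl 2 0
| Move3S of sl & cap = 3 : move_spec b so lo cap sl 3 0
| Move1L of gsL S <= b : move_spec b so lo cap sl 0 1
| Move1S1L of sl : move_spec b so lo cap sl 1 1.

(** A bin of size at most [4 * S - 3] carries weight at most 3, which leaves six fillings; the last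
    hypothesis is what validity says about a skipped bin. *)
Lemma moveP b so lo x y : b <= gsM S -> x * S + y * gsL S <= b ->
  (x = 0 -> y = 0 -> so = 0 /\ (gsL S <= b -> lo = 0)) ->
  move_spec b so lo (capS S b) (3 * S - 1 <= b) x y.
Proof.
rewrite /gsM => h1 h2 ne.
have y1 : y <= 1 by rewrite /gsL in h2; nia.
have x3 : x <= 3 by nia.
have xy2 : x + y.*2 <= 3 by rewrite /gsL in h2; nia.
case: y h2 y1 xy2 ne => [|[|//]] h2 _; case: x h2 x3 => [|[|[|[|//]]]] h2 _ xy2 ne //;
  try (by case: (ne erefl erefl); constructor);
  constructor; rewrite /capS; rewrite /gsL in h2 *; lia.
Qed.

(** While [q <= Q] the first estimate suffices; once [g] reaches [G] the second does, since
    [s <= 2 * (g + Q)] trades [s] for [Q]. *)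
Lemma both_bound H cA iA cO lo q g so e : q <= Q \/ G <= g ->
  cA + H * iA <= cO + H * (so + lo + q + e) ->
  2 * cA + H * (2 * (iA + g)) <= 2 * cO + H * (so + 2 * lo + s + 2 * e) ->
  cA + H * iA <= cO + H * (so + lo + Q + e).
Proof.
move=> [hq h1 _|hg _ h2].
  have : H * q <= H * Q by rewrite leq_mul2l hq orbT.
  lia.
have : H * s <= H * (2 * (g + Q)) by rewrite leq_mul2l; lia.
lia.
Qed.

(** Here [e] covers the room for S-items wasted in the bin where they run out, hence [e = 0] while
    some remain. *)
Lemma both_next sr lr q g cA so lo cO e :
  e <= 2 -> (0 < sr -> e = 0) -> g <= G -> (g = 0 \/ Q <= q) ->
  (q <= Q \/ G <= g) ->
  sr + 2 * lr <= so + 2 * lo + e -> lr <= lo + g -> lr + q <= l -> so <= s ->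
  (0 < so -> cA = cO) ->
  cA + gsL S * (sr + lr) <= cO + gsL S * (so + lo + q + e) ->
  2 * cA + gsL S * (2 * (sr + lr + g)) <=
    2 * cO + gsL S * (so + 2 * lo + s + 2 * e) ->
  invariant S s l Q G Y sr lr q g cA so lo cO.
Proof.
move=> e2 e0 gG gQ qQ hv hlg hlq hso hc h1 h2.
have hJ := both_bound _ _ _ _ _ _ _ _ _ qQ h1 h2.
have HQY : gsL S * (2 * Q + 6) <= gsL S * Y by rewrite leq_mul2l QY orbT.
have mulH m n : m <= n -> gsL S * m <= gsL S * n by move=> mn; rewrite leq_mul2l mn orbT.
have he := mulH _ _ e2; have hvH := mulH _ _ hv.
case: (posnP sr) => sr0; case: (posnP lr) => lr0; case: (posnP so) => so0.
- by rewrite sr0 lr0 so0 in hJ *; apply: InvDone => //; right; split; lia.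
- by apply: InvDone => //; left; rewrite hc.
- by rewrite sr0 so0 in hJ hv *; apply: InvLargeBehind => //; lia.
- apply: (InvLargeAhead _ _ _ _ _ _ _ _ _ _ _ _ _ _ (lr - lo) lr) => //.
  (* With [g = 0] there is no surplus of L-items; otherwise [Q <= q] yields the premise [m + Q <= l]
     of [uY]. *)
  + case: gQ => [g0|qQ']; last by apply: uY; lia.
    have -> : lr - lo = 0 by lia.
    by rewrite muln0 min0n.
  + by rewrite hc.
  + by lia.
  + by rewrite sr0 in hvH; rewrite hc //; lia.
- by rewrite lr0 (e0 sr0) in hJ *; apply: InvSmall => //; lia.
- by rewrite lr0 (e0 sr0) in hJ *; apply: InvSmall => //; lia.
- by rewrite (e0 sr0) in hv h1 h2; apply: InvBoth => //; lia.
- by rewrite (e0 sr0) in hv h1 h2; apply: InvBoth => //; lia.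
Qed.

(** Here [so] and [lo] are the counts after the bin; the step lemmas assume the invariant at
    [so + x] and [lo + y], which avoids truncated subtraction. *)
Definition bin_step b sr lr q g cA so lo cO x y (d : nat * nat) :=
 invariant S s l Q G Y (sr - d.1) (lr - d.2) (q + (flex S b && (0 < d.2)))
   (g + (flex S b && (d.2 == 0))) (cA + paid b d) so lo (cO + paid b (x, y)).

Lemma step_large sr lr q g cA so lo cO b x y :
  S <= b -> b <= gsM S -> x * S + y * gsL S <= b ->
  (x = 0 -> y = 0 -> so = 0 /\ (gsL S <= b -> lo = 0)) ->
  sr = 0 -> 0 < lr ->
  invariant S s l Q G Y sr lr q g cA (so + x) (lo + y) cO ->
  bin_step b sr lr q g cA so lo cO x y (pack_bin S Q G sr lr q g b).
Proof.
move=> Sb bM xyb ne sr0 lr0.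
rewrite /bin_step /pack_bin sr0 (gtn_eqF lr0) eqxx.
have mv := moveP _ _ _ _ _ bM xyb ne.
have Hb : b <= 2 * gsL S by rewrite /gsM in bM; rewrite /gsL; lia.
have HS : 2 * S = gsL S + 1 by rewrite /gsL; lia.
have H0 : 0 < gsL S by lia.
have HQY : gsL S * (2 * Q + 6) <= gsL S * Y by rewrite leq_mul2l QY orbT.
move=> inv.
have mulH m n : m <= n -> gsL S * m <= gsL S * n by move=> mn; rewrite leq_mul2l mn orbT.
case: inv => [h|h|_ _ sx0 hl hJ|u m _ _ hY hc hl hB|_ _ sx0 lx0 hB|h1 h2]; try lia.
- case: (ltnP b (gsL S)) => hb; case: mv sx0 hl hJ => [hs hlo||hb2 _|hb2 _|hb2|hb2] sx0 hl hJ;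
   rewrite /paid /= ?addn0 ?subn0 in sx0 hl hJ *; try lia.
  + by apply: InvLargeBehind; lia.
  (* Skipping this bin forces [lo = 0], hence [lr = 1]; the last L-item may cost [2 * gsL S], which
     uses up the 6 in [QY]. *)
  + have := hlo hb => lo0.
    have lr1 : lr = 1 by lia.
    rewrite lr1 in hJ *.
    by apply: InvDone => //; right; split; lia.
  + case: (ltnP 1 lr) => lr1.
      by apply: InvLargeBehind; lia.
    have lr1' : lr = 1 by lia.
    rewrite lr1' in hJ *.
    by apply: InvDone => //; right; split; lia.
- case: (posnP (so + x + (lo + y))) => [all0|pos].
    have [x0 [y0 [s0 l0]]] : x = 0 /\ y = 0 /\ so = 0 /\ lo = 0 by lia.
    rewrite x0 y0 s0 l0 !addn0 in hl hB *.
    (* Now [lr <= u]: if [4 * u] is the minimum, [cA <= cO] suffices; otherwise the bound on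
       [3 * lr] is used. *)
    have : 2 * cA + gsL S * (4 * lr) <= 2 * cO + gsL S * Y.
      have h1 := mulH _ _ hl; have h2 := mulH _ _ hY.
      move: h2; rewrite /minn; case: ifP => _ h2; lia.
    rewrite /paid /=; case: (ltnP b (gsL S)) => hb hB2; rewrite /= ?addn0 ?subn0.
      by apply: InvLargeOnly.
    case: (ltnP 1 lr) => lr1.
      by apply: InvLargeOnly => //; lia.
    have lr1' : lr = 1 by lia.
    rewrite lr1' in hB2 *.
    by apply: InvDone => //; right; split => //; lia.
  case: (ltnP b (gsL S)) => hb; rewrite /= ?addn0 ?subn0.
    have [y0 hx] : y = 0 /\ (x = 0 \/ x = 1) by case: mv {ne xyb pos hl hB} => *; lia.
    rewrite {}y0 in pos hl hB *.
    by case: hx pos hB => -> pos hB; rewrite /paid /= ?addn0 in hl hB *;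
      apply: (InvLargeAhead _ _ _ _ _ _ _ _ _ _ _ _ _ _ u m) => //; lia.
  have -> : paid b (x, y) = b.
    by case: mv pos {ne xyb hl hB} => [hs hlo|||||] //= pos; have := hlo hb; lia.
  rewrite [paid b (0, _)](_ : _ = b) //.
  (* Hence the coefficient 3 in [InvLargeAhead]: the algorithm packs one L-item while the other
     packing places weight at most 3. *)
  have vol : x + 2 * y <= 3.
    by case: mv {ne xyb hl hB pos} => *; lia.
  have volH := mulH _ _ vol.
  case: (ltnP 1 lr) => lr1.
    apply: (InvLargeAhead _ _ _ _ _ _ _ _ _ _ _ _ _ _ u m) => //; try lia.
  by apply: InvDone; lia.
- case: (ltnP b (gsL S)) => hb; rewrite /paid /= ?addn0 ?subn0.
    have [-> ->] : x = 0 /\ y = 0 by lia.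
    by rewrite addn0; apply: InvLargeOnly; lia.
  have [-> ->] : x = 0 /\ y = 0 by lia.
  rewrite /= addn0.
  case: (ltnP 1 lr) => lr1.
    by apply: InvLargeOnly; lia.
  have lr1' : lr = 1 by lia.
  rewrite lr1' in hB *.
  by apply: InvDone => //; right; split => //; lia.
Qed.

Lemma step_small sr lr q g cA so lo cO b x y :
  S <= b -> b <= gsM S -> x * S + y * gsL S <= b ->
  (x = 0 -> y = 0 -> so = 0 /\ (gsL S <= b -> lo = 0)) ->
  lr = 0 ->
  invariant S s l Q G Y sr lr q g cA (so + x) (lo + y) cO ->
  bin_step b sr lr q g cA so lo cO x y (pack_bin S Q G sr lr q g b).
Proof.
move=> Sb bM xyb ne lr0.
rewrite /bin_step /pack_bin lr0 eqxx /= subn0.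
have mv := moveP _ _ _ _ _ bM xyb ne.
have HS : 2 * S = gsL S + 1 by rewrite /gsL; lia.
have H0 : 0 < gsL S by lia.
have HQY : gsL S * (2 * Q + 6) <= gsL S * Y by rewrite leq_mul2l QY orbT.
(* A bin filled with S-items costs at most [gsL S] per item, the charge used in [InvSmall]. *)
have Hb : b <= gsL S * capS S b.
  rewrite /gsM in bM; rewrite /capS; case: (leqP (2 * S) b); case: (leqP (3 * S) b) => *; lia.
have mulH m n : m <= n -> gsL S * m <= gsL S * n by move=> mn; rewrite leq_mul2l mn orbT.
have cap3 : 0 < capS S b <= 3 by rewrite /capS; lia.
have xycap : x + y <= capS S b by case: mv {ne xyb} => *; unfold capS in *; lia.
case=> [|h sr0 h1 hJ|||u m|h1 _ h2]; try lia.
- have pb : paid b (minn (capS S b) sr, 0) = b.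
    by rewrite /paid xpair_eqE; case: eqP => //; lia.
  rewrite pb.
  have pO : paid b (x, y) <= b by rewrite /paid; case: ifP.
  have pO0 : 0 < x + y -> paid b (x, y) = b.
    by rewrite /paid xpair_eqE; case: eqP; case: eqP => //=; lia.
  have pO1 : 0 < so + x -> paid b (x, y) = b by case: mv {ne xyb xycap pO pO0 h1 hJ} => //= *; lia.
  case: (ltnP (capS S b) sr) => hc.
    have [sr' srE] : exists sr', sr = sr' + capS S b by exists (sr - capS S b); lia.
    rewrite srE addnK in hJ *; apply: InvSmall => //; try lia.
    have mc := mulH _ _ xycap.
    case: (posnP (x + y)) => [xy0|xy]; last by rewrite pO0 //; lia.
    have [x0 y0] : x = 0 /\ y = 0 by lia.
    by rewrite x0 y0 in hJ *; rewrite /paid /=; lia.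
  rewrite subnn.
  apply: InvDone => //.
  case: (posnP (so + x)) => [so0|so1]; last by left; rewrite h1 ?pO1.
  right; split; first by lia.
  have hb3 : gsL S * capS S b <= gsL S * (sr + 2) by apply: mulH; lia.
  have hs1 := mulH _ _ sr0.
  case: (posnP (x + y)) => [xy0|xy].
    have [-> y0] : x = 0 /\ y = 0 by lia.
    by rewrite y0 in hJ *; rewrite so0 in hJ; rewrite /paid /=; lia.
  have y1 : y = 1 by case: mv {ne xyb xycap pO pO0 pO1 hJ} so0 xy; lia.
  by rewrite pO0 //; rewrite so0 y1 in hJ *; lia.
- rewrite h1 minn0 /paid /= addn0; apply: InvDone => //.
  case: h2 => [h2|[so0 h2]]; first by left; lia.
  right; split; first by lia.
  case: mv {ne xyb xycap} so0 h2 => *; rewrite /= ; lia.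
Qed.

Local Ltac close_both e :=
  apply: (both_next _ _ _ _ _ _ _ _ e);
  rewrite ?subn0 ?subSS ?subn0 ?addn0 //=;
  match goal with mv : move_spec _ _ _ _ _ _ _ |- _ => destruct mv end;
  rewrite /paid /=; lia.

(** Apart from [e], the algorithm packs the largest weight that fits, so
    [sr + 2 * lr <= so + 2 * lo] persists and the other packing cannot skip a bin of size at least
    [gsL S]. *)
Lemma step_both sr lr q g cA so lo cO b x y :
  S <= b -> b <= gsM S -> x * S + y * gsL S <= b ->
  (x = 0 -> y = 0 -> so = 0 /\ (gsL S <= b -> lo = 0)) ->
  0 < sr -> 0 < lr ->
  invariant S s l Q G Y sr lr q g cA (so + x) (lo + y) cO ->
  bin_step b sr lr q g cA so lo cO x y (pack_bin S Q G sr lr q g b).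
Proof.
move=> Sb bM xyb ne; case: sr => // sr _; case: lr => // lr _.
rewrite /bin_step /pack_bin !eqn0Ngt !ltn0Sn /=.
have mv := moveP _ _ _ _ _ bM xyb ne.
have HS : 2 * S = gsL S + 1 by rewrite /gsL; lia.
have H0 : 0 < gsL S by lia.
case=> [_ _ gG gQ qQ hv hlg hlq hso hc h1 h2||||u m|]; try lia.
have pO1 : 0 < so + x -> paid b (x, y) = b.
  by case: mv {ne xyb hv hlg hlq hso hc h1 h2} => //= *; lia.
have hcO : 0 < so -> cA + b = cO + paid b (x, y).
  by move=> so1; rewrite pO1 ?hc //; lia.
move: mv; case: (binP _ Sb bM) => [hb|hb|hb hb2|hb hb2|hb hb2] mv /=.
- by close_both 0.
- by close_both 0.
- case: ifP => [/andP[Qq gG']|stage].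
    (* The S-count is [sr.+1] here: at [sr = 0] the S-items run out with room to spare, which is
       charged to [e = 2]. *)
    by case: sr h1 h2 hv hc hcO => [|sr] h1 h2 hv hc hcO;
      [rewrite [minn _ _](_ : _ = 1) // | rewrite [minn _ _](_ : _ = 2); last lia];
      [close_both 2 | close_both 0].
  have stage' : q < Q \/ G <= g by lia.
  by close_both 0.
- by close_both 0.
- case: ifP => [/andP[Qq gG']|stage].
    by case: sr h1 h2 hv hc hcO => [|[|sr]] h1 h2 hv hc hcO;
      [rewrite [minn _ _](_ : _ = 1) // | rewrite [minn _ _](_ : _ = 2) //
      | rewrite [minn _ _](_ : _ = 3); last lia];
      [close_both 2 | close_both 2 | close_both 0].
  have stage' : q < Q \/ G <= g by lia.
  by close_both 0.
Qed.
Lemma invariant_step sr lr q g cA so lo cO b x y :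
  S <= b -> b <= gsM S -> x * S + y * gsL S <= b ->
  (x = 0 -> y = 0 -> so = 0 /\ (gsL S <= b -> lo = 0)) ->
  invariant S s l Q G Y sr lr q g cA (so + x) (lo + y) cO ->
  bin_step b sr lr q g cA so lo cO x y (pack_bin S Q G sr lr q g b).
Proof.
move=> Sb bM xyb ne; case: (posnP lr) => lr0; first exact: step_small.
by case: (posnP sr) => sr0; [apply: step_large | apply: step_both].
Qed.

End Step.

(** * Choice of the quotas *)

(* 12 (f - 1) (s + 2l), an integer in each regime; see [fratio_target]. *)
Definition target12 (s l : nat) : nat :=
  if 2 * l <= s then 12 * l
  else if 6 * l <= 5 * s then 3 * s + 6 * l else 8 * s.

(** These are tau / 2, s / 2 - tau / 2 and tau up to additive constants that absorb rounding and
    boundary losses. The subtraction never truncates, as [target12 s l <= 8 * s]. *)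
Definition quotaL (s l : nat) : nat := target12 s l %/ 24 + 1.
Definition quotaS (s l : nat) : nat := (12 * s - target12 s l) %/ 24 + 1.
Definition slackY (s l : nat) : nat := target12 s l %/ 12 + 9.

Lemma quota_cover s l : s <= 2 * (quotaS s l + quotaL s l).
Proof. rewrite /quotaS /quotaL; lia. Qed.

Lemma quotaL_slack s l : 2 * quotaL s l + 6 <= slackY s l.
Proof. rewrite /slackY /quotaL; lia. Qed.

(** Up to rounding, in the three regimes: [m <= l / 2] and [u <= m] give [m + u <= l];
    [m <= l - quotaL s l] and [u <= quotaS s l] give [m + u <= s / 4 + l / 2]; [u <= s / 6] gives
    [4 * u <= 2 * s / 3]. *)
Lemma quota_slack s l u m : u <= quotaS s l -> u <= m -> m + quotaL s l <= l ->
  minn (4 * u) (m + u + 2) <= slackY s l.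
Proof.
rewrite /slackY /quotaL /quotaS /target12.
case: ifP => h1; last case: ifP => h2; rewrite /minn; case: ifP; lia.
Qed.

(** * The online algorithm and its behaviour on one bin *)

Definition state : Type := nat * nat * nat * nat.

Definition next_state (S Q G : nat) (st : state) (b : nat) : state :=
  let: (sr, lr, q, g) := st in
  let d := pack_bin S Q G sr lr q g b in
  (sr - d.1, lr - d.2, q + (flex S b && (0 < d.2)),
   g + (flex S b && (d.2 == 0))).

Definition after (S s l : nat) (sigma : seq nat) : state :=
  foldl (next_state S (quotaL s l) (quotaS s l)) (s, l, 0, 0) sigma.

(** An online algorithm sees only the prefix of bins, so the state is recomputed by replaying all
    but the last. *)
Definition grid_alg : online_alg := fun S s l sigma =>
  let: (sr, lr, q, g) := after S s l (take (size sigma).-1 sigma) in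
  pack_bin S (quotaL s l) (quotaS s l) sr lr q g (last 0 sigma).

Lemma after_take S s l sigma n : n < size sigma ->
  after S s l (take n.+1 sigma) =
  next_state S (quotaL s l) (quotaS s l) (after S s l (take n sigma)) (bin sigma n).
Proof. by move=> h; rewrite (take_nth 0 h) /after foldl_rcons. Qed.

Lemma run_grid_alg S s l sigma n sr lr q g : n < size sigma ->
  after S s l (take n sigma) = (sr, lr, q, g) ->
  run grid_alg S s l sigma n =
  pack_bin S (quotaL s l) (quotaS s l) sr lr q g (bin sigma n).
Proof.
move=> h hst; rewrite /run /grid_alg size_take_min.
have -> : (minn n.+1 (size sigma)).-1 = n by lia.
by rewrite take_takel // hst (take_nth 0 h) last_rcons.
Qed.

Lemma pack_bin_le S Q G sr lr q g b :
  (pack_bin S Q G sr lr q g b).1 <= sr /\ (pack_bin S Q G sr lr q g b).2 <= lr.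
Proof.
rewrite /pack_bin; case: eqP => [->|/eqP lr0]; first by rewrite geq_minr.
case: eqP => [->|/eqP sr0]; first by rewrite /=; lia.
case: ifP => _; first by rewrite /=; lia.
by case: ifP => _; rewrite /=; lia.
Qed.

Lemma pack_bin_fits S Q G sr lr q g b : 1 < S -> S <= b ->
  (pack_bin S Q G sr lr q g b).1 * S + (pack_bin S Q G sr lr q g b).2 * gsL S <= b.
Proof.
move=> S2 Sb.
have cap : capS S b * S <= b.
  by rewrite /capS; case: (leqP (2 * S) b); case: (leqP (3 * S) b); lia.
have capm : minn (capS S b) sr * S <= b.
  by apply: leq_trans cap; rewrite leq_mul2r geq_minl orbT.
rewrite /pack_bin; case: eqP => _; first by rewrite /= mul0n addn0.
case: eqP => _; first by rewrite /=; case: (leqP (gsL S) b) => /=; lia.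
case: ltnP => hb; first by rewrite /=; lia.
case: ifP => _; first by rewrite /= mul0n addn0.
by case: (leqP (3 * S - 1) b); rewrite /gsL /= in hb *; lia.
Qed.

Lemma pack_bin_empty S Q G sr lr q g b : S <= b ->
  pack_bin S Q G sr lr q g b = (0, 0) -> sr = 0 /\ (gsL S <= b -> lr = 0).
Proof.
move=> Sb; rewrite /pack_bin; case: eqP => [->|/eqP lr0].
  by rewrite /capS => -[]; lia.
case: eqP => [-> [] |/eqP sr0]; first by case: leqP.
case: ltnP => hb //; case: ifP => // _.
by rewrite /capS => -[]; lia.
Qed.

(** * Validity of the computed packing *)

Section Run.
Variables (S s l : nat) (sigma : seq nat).
Hypothesis S2 : 1 < S.
Hypothesis adm : admissible S s l sigma.

Let A := run grid_alg S s l sigma.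
Let st n := after S s l (take n sigma).
Let remS n := (st n).1.1.1.
Let remL n := (st n).1.1.2.

Lemma bin_bounds i : i < size sigma -> S <= bin sigma i <= gsM S.
Proof. by case/and3P: adm => /allP h _ _ hi; apply: h; rewrite mem_nth. Qed.

Lemma stP n : n < size sigma -> exists q g,
  [/\ st n = (remS n, remL n, q, g),
      A n = pack_bin S (quotaL s l) (quotaS s l) (remS n) (remL n) q g (bin sigma n) &
      st n.+1 = (remS n - (A n).1, remL n - (A n).2,
        q + (flex S (bin sigma n) && (0 < (A n).2)),
        g + (flex S (bin sigma n) && ((A n).2 == 0)))].
Proof.
move=> hn; rewrite /remS /remL; case E: (st n) => [[[sr lr] q] g]; exists q, g.
have AE : A n = pack_bin S (quotaL s l) (quotaS s l) sr lr q g (bin sigma n).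
  exact: run_grid_alg.
by split=> //; rewrite AE /st after_take // -/(st n) E.
Qed.

Lemma rem_next n : n < size sigma ->
  remS n.+1 = remS n - (A n).1 /\ remL n.+1 = remL n - (A n).2.
Proof. by move=> /stP[q [g [_ _ stE]]]; rewrite {1}/remS {1}/remL stE. Qed.

Lemma run_le n : n < size sigma -> (A n).1 <= remS n /\ (A n).2 <= remL n.
Proof. by move=> /stP[q [g [_ -> _]]]; apply: pack_bin_le. Qed.

Lemma run_empty n : n < size sigma -> A n = (0, 0) ->
  remS n = 0 /\ (gsL S <= bin sigma n -> remL n = 0).
Proof.
move=> hn; have [q [g [_ -> _]]] := stP n hn; apply: pack_bin_empty.
by case/andP: (bin_bounds n hn).
Qed.

Lemma remS_sum n : n <= size sigma -> remS n + \sum_(0 <= i < n) (A i).1 = s.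
Proof.
elim: n => [_|n IH hn]; first by rewrite big_geq // addn0 /remS /st take0.
have [h _] := run_le n hn; have [-> _] := rem_next n hn.
by rewrite big_nat_recr //= -[RHS](IH (ltnW hn)); lia.
Qed.

Lemma remL_sum n : n <= size sigma -> remL n + \sum_(0 <= i < n) (A i).2 = l.
Proof.
elim: n => [_|n IH hn]; first by rewrite big_geq // addn0 /remL /st take0.
have [_ h] := run_le n hn; have [_ ->] := rem_next n hn.
by rewrite big_nat_recr //= -[RHS](IH (ltnW hn)); lia.
Qed.

Lemma bin_tail i : size sigma - (s + l) <= i < size sigma -> bin sigma i = gsM S.
Proof.
case/and3P: adm => _ _ /allP h /andP[h1 h2]; apply/eqP.
have -> : bin sigma i = nth 0 (drop (size sigma - (s + l)) sigma) (i - (size sigma - (s + l))).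
  by rewrite nth_drop /bin; congr nth; lia.
by apply: h; rewrite mem_nth // size_drop ltn_sub2r // (leq_ltn_trans h1).
Qed.

(** Each of the last [s + l] bins has size [gsM S], so it receives an item as long as any
    remains. *)
Lemma rem_end n : size sigma - (s + l) <= n -> n <= size sigma ->
  remS n + remL n <= size sigma - n.
Proof.
have sz : s + l <= size sigma by case/and3P: adm.
elim: n => [|n IH] h1 h2.
  have := remS_sum 0 isT; have := remL_sum 0 isT; rewrite !big_geq //; lia.
have [h|h] := leqP (size sigma - (s + l)) n; last first.
  have := remS_sum _ h2; have := remL_sum _ h2; lia.
have {IH} := IH h (ltnW h2).
have [-> ->] := rem_next n h2; have [] := run_le n h2.
case: (posnP ((A n).1 + (A n).2)) => [a0|]; last by lia.
have A0 : A n = (0, 0) by case: (A n) a0 => a1 a2 /= a0; congr pair; lia.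
have [-> ->] := run_empty n h2 A0; first by lia.
by rewrite bin_tail ?h // /gsL /gsM; lia.
Qed.

Lemma rem_size : remS (size sigma) = 0 /\ remL (size sigma) = 0.
Proof. have := rem_end (size sigma); lia. Qed.

Lemma run_packed : packedS sigma A = s /\ packedL sigma A = l.
Proof.
rewrite /packedS /packedL -!(big_mkord xpredT (fun i => _ (A i))).
have [h1 h2] := rem_size.
by have := remS_sum _ (leqnn _); have := remL_sum _ (leqnn _); rewrite h1 h2.
Qed.

Lemma run_valid : valid_packing S s l sigma A.
Proof.
have [hS hL] := run_packed; have [eS eL] := rem_size.
rewrite /valid_packing hS hL !eqxx !andbT /valid /partial_packing hS hL !leqnn !ltnn.
rewrite !andbT /=; apply/andP; split; apply/allP => i; rewrite mem_iota add0n => /= hi.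
  have [q [g [_ -> _]]] := stP i hi.
  by apply: pack_bin_fits => //; case/andP: (bin_bounds i hi).
apply/implyP => /eqP A0; have [r0 r1] := run_empty i hi A0.
(* Stated for both kinds at once: remaining counts never grow, so a kind that is exhausted appears
   in no later bin. *)
have later (f : nat * nat -> nat) (rem : nat -> nat) :
  rem i = 0 -> (forall n, n < size sigma -> rem n.+1 = rem n - f (A n) /\ f (A n) <= rem n) ->
  ~~ has (fun j => 0 < f (A j)) (iota i.+1 (size sigma - i.+1)).
  move=> ri hrem; apply/hasPn => j; rewrite mem_iota => hj.
  have rj k : i + k < size sigma -> rem (i + k) = 0.
    elim: k => [|k IH]; first by rewrite addn0.
    rewrite addnS => hk; have [-> _] := hrem _ (ltnW hk).
    by rewrite IH // ltnW.
  have hjs : i + (j - i) < size sigma by lia.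
  have := hrem _ hjs; rewrite rj // subnKC; last by lia.
  by case=> _; rewrite leqn0 => /eqP ->.
apply/andP; split; apply/implyP.
  rewrite (negPf (later (fun x => x.1) remS r0 _)) // => n hn.
  by have [-> _] := rem_next n hn; have [] := run_le n hn.
apply: contraLR; rewrite -leqNgt => /r1 l0.
apply: (later (fun x => x.2) remL l0) => n hn.
by have [_ ->] := rem_next n hn; have [] := run_le n hn.
Qed.


(** * Comparison with an arbitrary valid packing *)

Section Compare.
Variable p : nat -> nat * nat.
Hypothesis p_ok : valid_packing S s l sigma p.

Let leftS n := \sum_(n <= i < size sigma) (p i).1.
Let leftL n := \sum_(n <= i < size sigma) (p i).2.

Lemma p_fits i : i < size sigma ->
  (p i).1 * S + (p i).2 * gsL S <= bin sigma i.
Proof.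
move=> hi; case/and3P: p_ok => /andP[/and3P[/allP h _ _] _] _ _.
by apply: h; rewrite mem_iota.
Qed.

Lemma p_total : leftS 0 = s /\ leftL 0 = l.
Proof. by case/and3P: p_ok => _ /eqP <- /eqP <-; rewrite /leftS /leftL !big_mkord. Qed.

(** This turns the validity of [p] into the skipping condition of [moveP]. *)
Lemma p_empty i : i < size sigma -> p i = (0, 0) ->
  leftS i.+1 = 0 /\ (gsL S <= bin sigma i -> leftL i.+1 = 0).
Proof.
move=> hi pi0; case/and3P: p_ok => /andP[_ /allP h] _ _.
have := h i; rewrite mem_iota hi /emptyb pi0 eqxx /= => /(_ isT) /andP[hS hL].
have none (f : nat * nat -> nat) :
  ~~ has (fun j => 0 < f (p j)) (iota i.+1 (size sigma - i.+1)) ->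
  \sum_(i.+1 <= j < size sigma) f (p j) = 0.
  move=> /hasPn hn; apply: big1_seq => j /andP[_ /hn].
  by rewrite -leqNgt leqn0 => /eqP.
split.
  apply: (none fst); apply/negP => hh; move: hS; rewrite hh orbT /=.
  by have := bin_bounds i hi; lia.
move=> hb; apply: (none snd); apply/negP => hh; move: hL; rewrite hh orbT /=.
by lia.
Qed.

Definition spent (r : nat -> nat * nat) n := \sum_(0 <= i < n) paid (bin sigma i) (r i).

Lemma cost_spent r : cost sigma r = spent r (size sigma).
Proof.
rewrite /cost /spent big_mkord big_mkcond; apply: eq_bigr => i _.
by rewrite /paid /emptyb; case: eqP.
Qed.

Lemma run_inv n : 0 < s -> 0 < l -> n <= size sigma -> exists q g,
  st n = (remS n, remL n, q, g) /\
  invariant S s l (quotaL s l) (quotaS s l) (slackY s l) (remS n) (remL n) q g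
    (spent A n) (leftS n) (leftL n) (spent p n).
Proof.
move=> s0 l0; elim: n => [_|n IH hn].
  exists 0, 0; rewrite /remS /remL /st take0; split=> //=.
  have [-> ->] := p_total; rewrite /spent !big_geq //.
  by apply: InvBoth => //=; try lia; left.
have [q [g [stE inv]]] := IH (ltnW hn).
have [q' [g' []]] := stP n hn.
rewrite stE => -[<- <-] AE stE'.
exists (q + (flex S (bin sigma n) && (0 < (A n).2))),
  (g + (flex S (bin sigma n) && ((A n).2 == 0))).
have [hS hL] := rem_next n hn.
split; first by rewrite stE' hS hL.
rewrite hS hL /spent !(big_nat_recr n) //= -/(spent A n) -/(spent p n).
have [Sb bM] := andP (bin_bounds n hn).
move: inv; rewrite {1}/leftS {1}/leftL !(big_ltn hn) -/(leftS n.+1) -/(leftL n.+1).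
(* [big_ltn] puts the current bin first, while the step lemma expects [so + x] and [lo + y]. *)
rewrite [X in invariant _ _ _ _ _ _ _ _ _ _ _ X]addnC
  [X in invariant _ _ _ _ _ _ _ _ _ _ _ _ X]addnC => inv.
have ne : (p n).1 = 0 -> (p n).2 = 0 -> leftS n.+1 = 0 /\ (gsL S <= bin sigma n -> leftL n.+1 = 0).
  by case E: (p n) => [x y] /= x0 y0; apply: p_empty => //; rewrite E x0 y0.
have step := invariant_step _ _ _ _ _ _ S2 (quota_cover s l) (quotaL_slack s l)
  (quota_slack s l) _ _ _ _ _ _ _ _ _ _ _ Sb bM (p_fits n hn) ne inv.
by move: step; rewrite /bin_step -AE -surjective_pairing.
Qed.

(** At the end both sides have nothing left, and [InvDone] is the only case compatible with that. *)
Lemma cost_compare : 0 < s -> 0 < l ->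
  2 * cost sigma A <= 2 * cost sigma p + gsL S * slackY s l.
Proof.
move=> s0 l0; have [q [g [_]]] := run_inv (size sigma) s0 l0 (leqnn _).
have [-> ->] := rem_size; rewrite /leftS /leftL !big_geq // !cost_spent.
by case=> *; lia.
Qed.

Lemma cost_lower : s * S + l * gsL S <= cost sigma p.
Proof.
have [<- <-] := p_total; rewrite cost_spent /leftS /leftL /spent !big_distrl -big_split /=.
rewrite !big_seq; apply: leq_sum => i; rewrite mem_index_iota => /andP[_ hi].
have := p_fits i hi; rewrite /paid; case: eqP => [->|//].
by [].
Qed.

End Compare.
End Run.

(** * From the additive loss to the ratio *)

Lemma cost_le_sum sigma r : cost sigma r <= \sum_(b <- sigma) b.
Proof.
rewrite /cost (big_nth 0) big_mkord big_mkcond /=.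
by apply: leq_sum => i _; case: ifP.
Qed.

Local Open Scope ring_scope.

Lemma fratio_target s l : (0 < s)%N -> (0 < l)%N ->
  (fratio s l - 1) * (12 * (s%:R + 2 * l%:R)) = (target12 s l)%:R.
Proof.
move=> s0 l0; have sp : 0 < s%:R :> rat by rewrite ltr0n.
have lp : 0 < l%:R :> rat by rewrite ltr0n.
have E1 : (l%:R <= s%:R / 2 :> rat) = (2 * l <= s)%N.
  by rewrite -(ler_nat rat) natrM; apply/idP/idP; lra.
have E2 : (l%:R <= 5 * s%:R / 6 :> rat) = (6 * l <= 5 * s)%N.
  by rewrite -(ler_nat rat) !natrM; apply/idP/idP; lra.
rewrite /fratio /target12 E1 E2; case: ifP => _; last case: ifP => _.
- by rewrite natrM; field; rewrite ?lt0r_neq0 //; lra.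
- by rewrite natrD !natrM; field.
- by rewrite natrM; field; rewrite ?lt0r_neq0 //; lra.
Qed.

Lemma fratio_ge1 s l : (0 < s)%N -> (0 < l)%N -> 1 <= fratio s l.
Proof.
move=> s0 l0; have sp : 0 < s%:R :> rat by rewrite ltr0n.
have lp : 0 < l%:R :> rat by rewrite ltr0n.
rewrite -subr_ge0 -(pmulr_lge0 (x := 12 * (s%:R + 2 * l%:R))); last by lra.
by rewrite fratio_target.
Qed.

Theorem theorem1 :
  exists (A : online_alg) (C : rat),
    correct_alg A /\ 0 < C /\
    forall (S s l : nat) (sigma : seq nat),
      (2 <= S)%N -> (0 < s)%N -> (0 < l)%N -> admissible S s l sigma ->
      (Acost A S s l sigma)%:R <= fratio s l * (OPT S s l sigma)%:R + C * S%:R.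
Proof.
(* The 9 is that of [slackY]: it costs [9 * gsL S / 2], less than [9 * S]. *)
exists grid_alg, 9; split; first by move=> *; exact: run_valid.
split=> // S s l sigma S2 s0 l0 adm.
have f1 := fratio_ge1 _ _ s0 l0.
(* The bound is shown for every value entering the minimum, including the default, which exceeds no
   less than every cost. *)
rewrite /OPT; apply: (big_ind (fun v : nat =>
  (Acost grid_alg S s l sigma)%:R <= fratio s l * v%:R + 9 * S%:R)).
- have := cost_le_sum sigma (run grid_alg S s l sigma).
  rewrite -(ler_nat rat) -/(Acost _ _ _ _ _) => h.
  have S0 : 0 <= S%:R :> rat by [].
  have v0 : 0 <= (\sum_(b <- sigma) b)%N%:R :> rat by [].
  by nra.
- by move=> x y hx hy; rewrite /minn; case: ifP.
move=> P hP.
have := cost_compare _ _ _ _ S2 adm _ hP s0 l0.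
have := cost_lower _ _ _ _ _ hP.
rewrite -/(Acost _ _ _ _ _); set c := cost _ _; set a := Acost _ _ _ _ _ => low cmp.
have lowH : (gsL S * (s + 2 * l) <= 2 * c)%N by rewrite /gsL in low *; nia.
have cmpH : (24 * a <= 24 * c + gsL S * target12 s l + 108 * gsL S)%N.
  have : (gsL S * (12 * slackY s l) <= gsL S * (target12 s l + 108))%N.
    by rewrite leq_mul2l /slackY; lia.
  by lia.
have HS : (gsL S <= 2 * S)%N by rewrite /gsL; lia.
move: lowH cmpH HS; rewrite -!(ler_nat rat) !(natrD, natrM) -fratio_target //.
move: (gsL S)%:R (fratio s l) f1 => H f f1 lowH cmpH HS.
(* Multiplying the volume bound by [f - 1] turns the additive loss (H / 2) tau into at most
   [(f - 1) * c]. *)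
have : (f - 1) * (H * (s%:R + 2 * l%:R)) <= (f - 1) * (2 * c%:R).
  by rewrite ler_wpM2l // subr_ge0.
by lra.
Qed.
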